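(* Let $\mu_1,\nu_1,\mu_2,\nu_2$ be compactly supported probability measures on $\mathbb R^d$, absolutely continuous with respect to Lebesgue measure, let $\alpha>0$, and let $$c_e(x,y,x',y')=\tfrac12|x-y|^2-\tfrac12|x'-y'|^2+\tfrac\alpha3\left[|x-x'|^2+(x-x')\cdot(y-y')+|y-y'|^2\right].$$ Fix $(\pi_1^*,\pi_2^* )\in\Pi(\mu_1,\nu_1)\times\Pi(\mu_2,\nu_2)$ and set $$c_{e,\pi_2^*}(x,y)=\int c_e(x,y,x',y')\,d\pi_2^*(x',y'),\qquad c_{e,\pi_1^*}(x',y')=\int c_e(x,y,x',y')\,d\pi_1^*(x,y).$$ Then the following pair of (coupled) duality equalities holds: $$\inf_{\pi_1\in\Pi(\mu_1,\nu_1)}\int c_{e,\pi_2^*}(x,y)\,d\pi_1(x,y)=\sup_{\varphi_1,\psi_1}\left(\int\varphi_1\,d\mu_1+\int\psi_1\,d\nu_1\right),$$ $$\sup_{\pi_2\in\Pi(\mu_2,\nu_2)}\int c_{e,\pi_1^*}(x',y')\,d\pi_2(x',y')=\inf_{\varphi_2,\psi_2}\left(\int-\varphi_2\,d\mu_2+\int-\psi_2\,d\nu_2\right).$$ Here the supremum is over $\varphi_1\in L^1(\mu_1)$, $\psi_1\in L^1(\nu_1)$ with $\varphi_1(x)+\psi_1(y)\le c_{e,\pi_2^*}(x,y)$, and the infimum is over $\varphi_2\in L^1(\mu_2)$, $\psi_2\in L^1(\nu_2)$ with $-\varphi_2(x')-\psi_2(y')\ge c_{e,\pi_1^*}(x'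,y')$.
   Context: $\Pi(\mu,\nu)$ denotes the set of couplings (transport plans) of $\mu$ and $\nu$, i.e. probability measures on $\mathbb R^d\times\mathbb R^d$ with first marginal $\mu$ and second marginal $\nu$. *)

(* Defs.v *)
From HB Require Import structures.
From mathcomp Require Import all_boot all_order all_algebra.
From mathcomp Require Import all_classical all_reals all_analysis.
From mathcomp Require Import measurable_realfun.
Import Order.TTheory GRing.Theory Num.Theory.
Import numFieldNormedType.Exports.

Set Implicit Arguments.
Unset Strict Implicit.
Unset Printing Implicit Defensive.

Local Open Scope classical_set_scope.
Local Open Scope ring_scope.
Local Open Scope ereal_scope.

(* R^d with its Borel sigma-algebra. *)
Definition Rd (R : realType) (d : nat) :=
  g_sigma_algebraType (@open 'rV[R]_d).

Section euclidean.
Context (R : realType) (d : nat).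
Implicit Types x y : 'rV[R]_d.

Definition dot x y : R := (\sum_(i < d) x ord0 i * y ord0 i)%R.

(* The library norm of 'rV[R]_d is the sup norm, hence this definition. *)
Definition enorm x : R := Num.sqrt (dot x x).

End euclidean.

(* Lebesgue measure on the Borel sets of R^d, as the d-fold iterated product
   of the one-dimensional one:
     lambda_(d+1)(A) = \int lambda_d {v | (t, v) \in A} dt. *)
Fixpoint lebesgue_rV (R : realType) (d : nat) : set 'rV[R]_d -> \bar R :=
  match d with
  | 0 => fun A => (\1_A (0%R : 'rV[R]_0))%:E
  | n.+1 => fun A => \int[lebesgue_measure]_(t in [set: R])
      lebesgue_rV [set v : 'rV[R]_n | A (row_mx (t%:M : 'rV[R]_1) v)]
  end.

Lemma lebesgue_rV_box (R : realType) (d : nat) (a b : 'I_d -> R) : (forall i, a i <= b i)%R ->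
  lebesgue_rV [set v : 'rV[R]_d | forall i, (a i <= v ord0 i <= b i)%R]
  = (\prod_i (b i - a i))%R%:E.
Proof.
elim: d a b => [|d IH] a b ab /=.
  by rewrite big_ord0 indicE mem_set//= => -[].
have hr t (v : 'rV[R]_d) (i : 'I_d) :
  (row_mx (t%:M : 'rV[R]_1) v : 'rV_d.+1) ord0 (lift ord0 i) = v ord0 i.
  have -> : lift ord0 i = rshift 1 i :> 'I_(1 + d) by apply: ord_inj.
  exact: row_mxEr.
have h0 t (v : 'rV[R]_d) :
  (row_mx (t%:M : 'rV[R]_1) v : 'rV_d.+1) ord0 ord0 = t.
  have -> : ord0 = lshift d (ord0 : 'I_1) :> 'I_(1 + d) by apply: ord_inj.
  by rewrite [LHS]row_mxEl mxE eqxx mulr1n.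
transitivity (\int[lebesgue_measure]_(t in [set: R])
  ((\prod_(i < d) (b (lift ord0 i) - a (lift ord0 i)))%R%:E
   * (\1_`[a ord0, b ord0]%classic t)%:E)); last first.
  rewrite ge0_integralZl//; first 1 last.
  - by apply/measurable_EFinP; exact: measurable_indic.
  - by rewrite lee_fin prodr_ge0// => i _; rewrite subr_ge0.
  rewrite integral_indic// setIT big_ord_recl.
  have := @lebesgue_measure_itv R `[a ord0, b ord0]; rewrite /= lte_fin => mab.
  rewrite [X in _ * X](_ : _ = (b ord0 - a ord0)%R%:E);
    first by rewrite -EFinM mulrC.
  rewrite [LHS]mab; case: ltP => H; first by rewrite -EFinB.
  by rewrite (@le_anti _ _ (a ord0) (b ord0)) ?ab ?H// subrr.
apply: eq_integral.
  move=> t _; rewrite indicE.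
  have [tab|tab] := boolP (t \in `[a ord0, b ord0]%classic).
    rewrite mule1.
    rewrite -(IH (fun i => a (lift ord0 i)) (fun i => b (lift ord0 i)))//.
    congr lebesgue_rV; apply/seteqP; split => v /=.
      by move=> H i; have := H (lift ord0 i); rewrite hr.
    move=> H i; have [j ->|->] := unliftP ord0 i; first by rewrite hr.
    by rewrite h0; move: tab; rewrite inE/= in_itv/=.
  rewrite mule0 (_ : [set v | _] = set0).
    clear; elim: d => [|d IH] /=; first by rewrite indicE in_set0.
    by rewrite integral0_eq.
  rewrite -subset0 => v /= /(_ ord0); rewrite h0 => H.
  by move/negP: tab; apply; rewrite inE/= in_itv.
Qed.

Section measures.
Context (R : realType) (d : nat).

Definition msupport (mu : set (Rd R d) -> \bar R) : set 'rV[R]_d :=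
  [set x | forall U : set 'rV[R]_d, open U -> U x -> 0 < mu U].

Definition compactly_supported (mu : set (Rd R d) -> \bar R) : Prop :=
  compact (msupport mu).

Definition abs_continuous (mu : set (Rd R d) -> \bar R) : Prop :=
  mu `<< (@lebesgue_rV R d : set (Rd R d) -> \bar R).

(* Measures take arbitrary values on non-measurable sets, so the marginals are
   compared on Borel sets only. *)
Definition coupling (mu nu : probability (Rd R d) R) :
    set (probability (Rd R d * Rd R d)%type R) :=
  [set pi | forall A : set (Rd R d), measurable A ->
      pushforward pi fst A = mu A /\ pushforward pi snd A = nu A].

End measures.

Section duality.
Context (R : realType) (d : nat).
Implicit Types (mu nu : probability (Rd R d) R) (c : Rd R d -> Rd R d -> \bar R).

Definition c_e (alpha : R) (x y x' y' : 'rV[R]_d) : R :=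
  (2^-1 * enorm (x - y) ^+ 2 - 2^-1 * enorm (x' - y') ^+ 2
   + alpha / 3 * (enorm (x - x') ^+ 2 + dot (x - x') (y - y')
                  + enorm (y - y') ^+ 2))%R.

Definition c_e_pi2 (alpha : R) (pi2 : probability (Rd R d * Rd R d)%type R)
    (x y : Rd R d) : \bar R :=
  \int[pi2]_z (c_e alpha x y z.1 z.2)%:E.

Definition c_e_pi1 (alpha : R) (pi1 : probability (Rd R d * Rd R d)%type R)
    (x' y' : Rd R d) : \bar R :=
  \int[pi1]_z (c_e alpha z.1 z.2 x' y')%:E.

Definition transport_costs mu nu c : set (\bar R) :=
  [set \int[pi]_z c z.1 z.2 | pi in coupling mu nu].

(* phi and psi are finite-valued representatives of L^1 functions, and the
   constraint is imposed at every (x, y), not almost everywhere. *)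
Definition dual_values_below mu nu c : set (\bar R) :=
  [set v | exists phi psi : Rd R d -> R,
    [/\ phi \in Lfun mu 1, psi \in Lfun nu 1,
        forall x y, (phi x + psi y)%:E <= c x y
      & v = \int[mu]_x (phi x)%:E + \int[nu]_y (psi y)%:E]].

Definition dual_values_above mu nu c : set (\bar R) :=
  [set v | exists phi psi : Rd R d -> R,
    [/\ phi \in Lfun mu 1, psi \in Lfun nu 1,
        forall x y, c x y <= (- phi x - psi y)%:E
      & v = \int[mu]_x (- phi x)%:E + \int[nu]_y (- psi y)%:E]].

End duality.

(* Main.v *)
(* Integrating out one plan leaves, up to sign, a cost
     p (|x|^2 + |y|^2) + q x.y + A.x + B.y + C,
   which is a finite sum of products u_k(x) v_k(y) with u_k and v_k bounded almost
   everywhere because the marginals have compact support.  For such a cost the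
   duality is a finite one up to an error: cut both spaces into finitely many
   cells on which every u_k, resp. v_k, is almost constant.  A coupling (p_ij) of
   the cell masses lifts to a coupling of mu and nu by spreading p_ij as a
   multiple of the product measure of the two cells, and dual vectors for the
   cells lift to step functions, so no weak compactness of the set of couplings
   and no representation theorem is used.  The finite duality itself follows by
   minimizing the squared residual of the linear system
     row sums = m, column sums = n, cost = V - eps
   over the cube [0,1]^(I x J): the residual at a minimizer is the multiplier. *)
Require Import Defs.
From HB Require Import structures.
From mathcomp Require Import all_boot all_order all_algebra.
From mathcomp Require Import finmap.
From mathcomp Require Import all_classical all_reals all_analysis.
From mathcomp Require Import measurable_realfun ring lra.
Import Order.TTheory GRing.Theory Num.Theory.
Import numFieldNormedType.Exports.

Set Implicit Arguments.
Unset Strict Implicit.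
Unset Printing Implicit Defensive.

Local Open Scope classical_set_scope.
Local Open Scope ring_scope.

(** * Finite transport duality *)

Section finite_transport.
Context (R : realType).

(** Let [p] be a point of the cube whose image under [a] is nearest to [b]. Moving from [p] towards
    any [q] of the cube cannot decrease the distance, so the residual at [p] has nonnegative scalar
    product with the image of [q - p]. The gap is therefore at least the squared distance [G p],
    which is positive because [b] is not attained. *)
Lemma zonotope_separation (E K : finType) (a : K -> E -> R) (b : K -> R) :
  (forall p : E -> R, (forall e, 0 <= p e <= 1) ->
    ~ (forall k, \sum_e a k e * p e = b k)) ->
  exists l : K -> R, forall q : E -> R, (forall e, 0 <= q e <= 1) ->
    \sum_k l k * b k < \sum_k l k * (\sum_e a k e * q e).
Proof.
move=> nosol.
(* Points of the cube are coded as row vectors through [enum_rank], so that compactness of boxes and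
   the extreme value theorem apply. *)
pose res (p : 'rV[R]_#|E|) k := \sum_e a k e * p ord0 (enum_rank e) - b k.
pose G p := \sum_k res p k ^+ 2.
pose cube := [set p : 'rV[R]_#|E| | forall i, `[0, 1]%classic (p ord0 i)].
have cube0 : cube !=set0 by exists 0 => i; rewrite /= mxE in_itv/= lexx ler01.
have cubeK : compact cube.
  apply: (@rV_compact R _ (fun=> `[0, 1]%classic)) => _; exact: segment_compact.
have Gc : continuous G.
  apply: continuous_big => [|k _]; first exact: add_continuous.
  have resc : continuous (res ^~ k).
    have sumc : continuous (fun p : 'rV[R]_#|E| => \sum_e a k e * p ord0 (enum_rank e)).
      apply: continuous_big => [|e _ p]; first exact: add_continuous.
      exact: (continuousM (@cst_continuous _ _ (a k e) p) (@coord_continuous R 1 _ _ _ p)).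
    by move=> p; exact: (continuousB (sumc p) (@cst_continuous _ _ (b k) p)).
  by move=> p; exact: (continuousM (resc p) (resc p)).
have [p pcube pmin] : exists2 p, p \in cube & forall q, q \in cube -> G p <= G q.
  by apply: EVT_min_rV => //; exact: continuous_subspaceT.
have p01 e : 0 <= p ord0 (enum_rank e) <= 1.
  by move: pcube; rewrite inE => /(_ (enum_rank e)); rewrite /= in_itv.
have Gp0 : 0 < G p.
  rewrite lt_neqAle sumr_ge0 ?andbT; last by move=> k _; exact: sqr_ge0.
  apply/negP => /eqP/esym/eqP; rewrite psumr_eq0; last by move=> k _; exact: sqr_ge0.
  move=> /allP G0; apply: (nosol (fun e => p ord0 (enum_rank e))) => // k.
  by have := G0 k; rewrite mem_index_enum sqrf_eq0 subr_eq0 => /(_ isT)/eqP.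
exists (res p) => q q01.
pose dr k := \sum_e a k e * (q e - p ord0 (enum_rank e)).
have first_order : 0 <= \sum_k res p k * dr k.
  rewrite leNgt; apply/negP => L0.
  set L := \sum_k _ in L0; pose Q := \sum_k dr k ^+ 2.
  have Q0 : 0 <= Q by apply: sumr_ge0 => k _; exact: sqr_ge0.
  (* Along the segment, [G] equals [G p + 2 t L + t^2 Q], with optimal step [- L / Q]. The larger
     denominator [Q - L] keeps the step in []0, 1]], also when [Q = 0], and still decreases [G],
     since then [2 L + t Q = L + t L < 0]. *)
  pose t := - L / (Q - L).
  have QL0 : 0 < Q - L by lra.
  have t0 : 0 < t by rewrite divr_gt0// oppr_gt0.
  have t1 : t <= 1 by rewrite ler_pdivrMr// mul1r; lra.
  pose pt := \row_i ((1 - t) * p ord0 i + t * q (enum_val i)).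
  have ptcube : pt \in cube.
    rewrite inE => i; rewrite /= mxE in_itv/=.
    have := q01 (enum_val i); have := p01 (enum_val i); rewrite enum_valK.
    by move=> /andP[? ?] /andP[? ?]; apply/andP; split; nra.
  have := pmin _ ptcube; apply/negP; rewrite -ltNge.
  have -> : G pt = G p + 2 * t * L + t ^+ 2 * Q.
    rewrite /G /L /Q !mulr_sumr -!big_split/=; apply: eq_bigr => k _.
    have -> : res pt k = res p k + t * dr k.
      rewrite /res /dr addrAC mulr_sumr -big_split/=; congr (_ - _).
      by apply: eq_bigr => e _; rewrite mxE enum_rankK; ring.
    by ring.
  have tQL : t * (Q - L) = - L by rewrite /t divfK// gt_eqF.
  rewrite -addrA gtrDl.
  suff : 2 * L + t * Q < 0 by nra.
  by nra.
have -> : \sum_k res p k * (\sum_e a k e * q e)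
    = \sum_k res p k * b k + (G p + \sum_k res p k * dr k).
  rewrite -!big_split/=; apply: eq_bigr => k _; rewrite expr2 -!mulrDr; congr (_ * _).
  rewrite /res /dr [b k + _]addrC addrAC subrK -big_split/=.
  by apply: eq_bigr => e _; ring.
by rewrite ltrDl ltr_pwDl.
Qed.

(** A total cost of [V - eps] is out of reach for couplings, so the system made of the marginal
    constraints and this cost equation has no solution in the cube. The separating multipliers,
    divided by the one of the cost equation, are almost the dual vectors sought. *)
Lemma finite_transport_duality (I J : finType) (m : I -> R) (n : J -> R)
    (c : I -> J -> R) (V eps : R) :
  (forall i, 0 <= m i) -> \sum_i m i = 1 ->
  (forall j, 0 <= n j) -> \sum_j n j = 1 ->
  (forall p : I -> J -> R, (forall i j, 0 <= p i j) ->
    (forall i, \sum_j p i j = m i) -> (forall j, \sum_i p i j = n j) ->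
    V <= \sum_i \sum_j c i j * p i j) ->
  0 < eps ->
  exists phi psi, (forall i j, phi i + psi j <= c i j) /\
    V - eps <= \sum_i phi i * m i + \sum_j psi j * n j.
Proof.
move=> m0 m1 n0 n1 Vmin eps0.
pose a (k : I + J + unit) (e : I * J) : R :=
  match k with
  | inl (inl i) => (e.1 == i)%:R
  | inl (inr j) => (e.2 == j)%:R
  | inr _ => c e.1 e.2
  end.
pose b (k : I + J + unit) : R :=
  match k with inl (inl i) => m i | inl (inr j) => n j | inr _ => V - eps end.
have sumK (F : I + J + unit -> R) : \sum_k F k =
    \sum_i F (inl (inl i)) + \sum_j F (inl (inr j)) + F (inr tt).
  by rewrite !big_sumType/=; congr (_ + _); rewrite (big_pred1 tt)//; case.
have sum_pair (F : I * J -> R) : \sum_e F e = \sum_i \sum_j F (i, j).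
  by rewrite pair_bigA; apply: eq_bigr => -[].
have row i (p : I * J -> R) : \sum_e a (inl (inl i)) e * p e = \sum_j p (i, j).
  rewrite sum_pair/=.
  rewrite (bigD1 i)//= [X in _ + X]big1 ?addr0; last first.
    by move=> i' ii'; rewrite big1// => j _; rewrite (negbTE ii') mul0r.
  by apply: eq_bigr => j _; rewrite eqxx mul1r.
have col j (p : I * J -> R) : \sum_e a (inl (inr j)) e * p e = \sum_i p (i, j).
  rewrite sum_pair/=; apply: eq_bigr => i _.
  rewrite (bigD1 j)//= eqxx mul1r big1 ?addr0// => j' jj'.
  by rewrite (negbTE jj') mul0r.
have cost (p : I * J -> R) :
    \sum_e a (inr tt) e * p e = \sum_i \sum_j c i j * p (i, j).
  by rewrite sum_pair.
have [|l lP] := @zonotope_separation _ _ a b.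
  move=> p p01 pb.
  have : V <= \sum_i \sum_j c i j * p (i, j).
    apply: (Vmin (fun i j => p (i, j))) => [i j|i|j].
    - by have /andP[] := p01 (i, j).
    - by rewrite -row pb.
    - by rewrite -col pb.
  by rewrite -cost pb/=; lra.
pose r i := l (inl (inl i)); pose s j := l (inl (inr j)); pose w := l (inr tt).
have sep q : (forall e, 0 <= q e <= 1) ->
    \sum_i r i * m i + \sum_j s j * n j + w * (V - eps)
    < \sum_i \sum_j (r i + s j + w * c i j) * q (i, j).
  move=> /lP; rewrite !sumK cost; under [X in _ < X + _ + _]eq_bigr do rewrite row.
  under [X in _ < _ + X + _]eq_bigr do rewrite col.
  move=> /lt_le_trans; apply.
  rewrite [X in _ + X + _](_ : _ = \sum_i \sum_j s j * q (i, j)); last first.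
    by rewrite exchange_big/=; apply: eq_bigr => j _; rewrite mulr_sumr.
  rewrite mulr_sumr -!big_split/=; apply: ler_sum => i _.
  rewrite !mulr_sumr -!big_split/=; apply: ler_sum => j _.
  by rewrite -/(r i) -/(s j) -/w le_eqVlt; apply/orP; left; apply/eqP; ring.
have m_le1 i : m i <= 1.
  by rewrite -m1 (bigD1 i)//= lerDl sumr_ge0.
have n_le1 j : n j <= 1.
  by rewrite -n1 (bigD1 j)//= lerDl sumr_ge0.
(* Tested on the product coupling, the marginal terms of [sep] cancel. What is left is
   [w (V - eps) < w * cost] with [cost >= V], which forces the sign of [w]. *)
have w0 : 0 < w.
  have := sep (fun e => m e.1 * n e.2).
  have -> : \sum_i \sum_j (r i + s j + w * c i j) * (m i * n j) =
      \sum_i r i * m i + \sum_j s j * n j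
      + w * \sum_i \sum_j c i j * (m i * n j).
    rewrite mulr_sumr.
    rewrite [X in _ + X + _](_ : _ = \sum_i \sum_j s j * n j * m i); last first.
      rewrite exchange_big/=; apply: eq_bigr => j _.
      by rewrite -mulr_sumr m1 mulr1.
    rewrite -!big_split/=; apply: eq_bigr => i _.
    rewrite -[r i * m i]mulr1 -n1 !mulr_sumr -!big_split/=; apply: eq_bigr => j _.
    by ring.
  have Vq : V <= \sum_i \sum_j c i j * (m i * n j).
    apply: (Vmin (fun i j => m i * n j)) => [i j|i|j]; first exact: mulr_ge0.
      by rewrite -mulr_sumr n1 mulr1.
    by rewrite -mulr_suml m1 mul1r.
  rewrite ltrD2l => H.
  have {}H : w * (V - eps) < w * (\sum_i \sum_j c i j * (m i * n j)).
    by apply: H => e; rewrite mulr_ge0//= mulr_ile1.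
  rewrite ltNge; apply/negP => w0.
  by move: H; apply/negP; rewrite -leNgt ler_wnM2l//; lra.
pose phi0 i := - r i / w; pose psi j := - s j / w.
(* [excess i] is the total violation of the dual constraints in row [i]; lowering
   [phi0] by it restores them all, and [m i <= 1] bounds the loss. *)
pose excess i := \sum_j Num.max 0 (phi0 i + psi j - c i j).
exists (fun i => phi0 i - excess i), psi; split.
  move=> i j.
  have : phi0 i + psi j - c i j <= excess i.
    rewrite /excess (bigD1 j)//= -[leLHS]addr0 lerD//.
      by rewrite le_max lexx orbT.
    by apply: sumr_ge0 => *; rewrite le_max lexx.
  lra.
(* The indicator of the entries that violate the dual constraint makes the right side of [sep] as
   small as possible on the cube, namely [- w] times the total excess. *)
pose q (e : I * J) : R := (r e.1 + s e.2 + w * c e.1 e.2 < 0)%R%:R.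
have := sep q.
have -> : \sum_i \sum_j (r i + s j + w * c i j) * q (i, j) = - w * \sum_i excess i.
  rewrite mulr_sumr; apply: eq_bigr => i _; rewrite mulr_sumr; apply: eq_bigr => j _.
  have rsw : r i + s j + w * c i j = - w * (phi0 i + psi j - c i j).
    by rewrite /phi0 /psi; field; rewrite gt_eqF.
  rewrite /q/= rsw mulNr oppr_lt0 pmulr_rgt0//.
  by case: ltP => _; rewrite ?mulr1 ?mulr0 ?mulNr.
have -> : \sum_i r i * m i = - w * \sum_i phi0 i * m i.
  by rewrite mulr_sumr; apply: eq_bigr => i _; rewrite /phi0; field; rewrite gt_eqF.
have -> : \sum_j s j * n j = - w * \sum_j psi j * n j.
  by rewrite mulr_sumr; apply: eq_bigr => j _; rewrite /psi; field; rewrite gt_eqF.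
move=> H.
have {}H : - w * (\sum_i phi0 i * m i) + - w * (\sum_j psi j * n j) + w * (V - eps)
    < - w * (\sum_i excess i).
  by apply: H => e; rewrite /q; case: (_ < 0); rewrite ?lexx ?ler01.
have {}H : V - eps < \sum_i phi0 i * m i + \sum_j psi j * n j - \sum_i excess i.
  by rewrite -(ltr_pM2l w0); lra.
apply: (le_trans (ltW H)).
under [X in _ <= X + _]eq_bigr do rewrite mulrBl.
rewrite sumrB addrAC lerD2r lerD2l lerN2.
apply: ler_sum => i _; rewrite ler_piMr//.
by apply: sumr_ge0 => *; rewrite le_max lexx.
Qed.

End finite_transport.

(** * Lifting discrete couplings *)

(** [Q] has density [\sum_e w e * \1_(C e)] with respect to [P]. It is built as a finite sum of
    scaled restrictions of [P]. *)
Lemma reweighted_probability d (T : measurableType d) (R : realType)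
    (P : {measure set T -> \bar R}) (E : finType) (C : E -> set T) (w : E -> R) :
  (forall e, measurable (C e)) -> (forall e, 0 <= w e) ->
  (\sum_e (w e)%:E * P (C e) = 1)%E ->
  exists Q : probability T R,
    forall A, Q A = (\sum_e (w e)%:E * P (A `&` C e))%E.
Proof.
move=> mC w0 w1.
pose term e : {measure set T -> \bar R} :=
  mscale (NngNum (w0 e)) (mrestr P (mC e)).
pose Q A := (\sum_e term e A)%E.
have Q0 : Q set0 = 0%E by rewrite /Q big1// => e _; rewrite measure0.
have Qge0 A : (0 <= Q A)%E by apply: sume_ge0 => e _; exact: measure_ge0.
have Qsig : semi_sigma_additive Q.
  move=> F mF tF mUF; rewrite /Q; under eq_fun do rewrite exchange_big/=.
  apply: cvg_nnesum => e _.
    by apply: nearW => n; apply: sume_ge0 => k _; exact: measure_ge0.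
  exact: (@measure_semi_sigma_additive _ _ _ (term e)).
pose Qm : {measure set T -> \bar R} := HB.pack Q (isMeasure.Build _ T R Q Q0 Qge0 Qsig).
have QT : Qm setT = 1%E.
  by rewrite -w1; apply: eq_bigr => e _; rewrite /= /mscale /= /mrestr setTI.
pose Qp : probability T R := HB.pack_for (probability T R) (Measure.sort Qm)
  (Measure_isProbability.Build _ T R Qm QT).
by exists Qp.
Qed.

Lemma measure_finite_partition d (T : measurableType d) (R : realType) (K : finType)
    (P : {measure set T -> \bar R}) (f : T -> K) (A : set T) :
  (forall i, measurable (f @^-1` [set i])) ->
  measurable A -> P A = (\sum_i P (A `&` f @^-1` [set i]))%E.
Proof.
move=> mf mA.
have {1}-> : A = \bigcup_(i in [set` index_enum K]) (A `&` f @^-1` [set i]).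
  apply/seteqP; split=> [x Ax|x [i _ []//]].
  by exists (f x); rewrite //= mem_index_enum.
rewrite measure_fin_bigcup//.
- by rewrite -fsbig_seq// index_enum_uniq.
- by move=> i j _ _ [x [[_ <-] [_ <-]]].
- by move=> i _; exact: measurableI.
Qed.

Section gluing.
Context d1 d2 (T1 : measurableType d1) (T2 : measurableType d2) (R : realType).
Context (I J : finType).

Local Open Scope ereal_scope.

(** On each rectangle of cells the product measure is rescaled to total mass [p i j]. Summed over
    [j], the first marginal restricted to cell [i] is [\sum_j p i j] times the normalized
    restriction of [mu], which is [mu] itself on that cell. The second marginal is symmetric. *)
Lemma discrete_coupling_lift (mu : probability T1 R) (nu : probability T2 R)
    (f : T1 -> I) (g : T2 -> J) (p : I -> J -> R) :
  (forall i, measurable (f @^-1` [set i])) ->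
  (forall j, measurable (g @^-1` [set j])) ->
  (forall i j, 0 <= p i j)%R ->
  (forall i, (\sum_j p i j)%:E = mu (f @^-1` [set i])) ->
  (forall j, (\sum_i p i j)%:E = nu (g @^-1` [set j])) ->
  exists pi : probability (T1 * T2)%type R,
  [/\ forall A, measurable A -> pi (fst @^-1` A) = mu A,
      forall B, measurable B -> pi (snd @^-1` B) = nu B
    & forall i j, pi (f @^-1` [set i] `*` g @^-1` [set j]) = (p i j)%:E].
Proof.
move=> mf mg p0 row col.
pose a A i := fine (mu (A `&` f @^-1` [set i])).
pose b B j := fine (nu (B `&` g @^-1` [set j])).
have aE A i : measurable A -> mu (A `&` f @^-1` [set i]) = (a A i)%:E.
  by move=> mA; rewrite fineK// fin_num_measure//; exact: measurableI.
have bE B j : measurable B -> nu (B `&` g @^-1` [set j]) = (b B j)%:E.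
  by move=> mB; rewrite fineK// fin_num_measure//; exact: measurableI.
have partA A : measurable A -> mu A = \sum_i (a A i)%:E.
  by move=> mA; rewrite (measure_finite_partition _ mf)//; apply: eq_bigr => i _; exact: aE.
have partB B : measurable B -> nu B = \sum_j (b B j)%:E.
  by move=> mB; rewrite (measure_finite_partition _ mg)//; apply: eq_bigr => j _; exact: bE.
have rowE i : (\sum_j p i j = a setT i)%R.
  by apply: EFin_inj; rewrite row -aE// setTI.
have colE j : (\sum_i p i j = b setT j)%R.
  by apply: EFin_inj; rewrite col -bE// setTI.
have p0a i j : a setT i = 0%R -> p i j = 0%R.
  rewrite -rowE => /eqP; rewrite psumr_eq0// => /allP/(_ j).
  by rewrite mem_index_enum => /(_ isT)/eqP.
have p0b i j : b setT j = 0%R -> p i j = 0%R.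
  rewrite -colE => /eqP; rewrite psumr_eq0// => /allP/(_ i).
  by rewrite mem_index_enum => /(_ isT)/eqP.
have a_ge0 A i : (0 <= a A i)%R by exact: fine_ge0.
have b_ge0 B j : (0 <= b B j)%R by exact: fine_ge0.
have a0 A i : measurable A -> a setT i = 0%R -> a A i = 0%R.
  move=> mA aT; apply/eqP; rewrite eq_le a_ge0 andbT -lee_fin -aT -!aE//.
  by apply: le_measure; rewrite ?inE; [exact: measurableI|exact: measurableI|exact: setSI].
have b0 B j : measurable B -> b setT j = 0%R -> b B j = 0%R.
  move=> mB bT; apply/eqP; rewrite eq_le b_ge0 andbT -lee_fin -bT -!bE//.
  by apply: le_measure; rewrite ?inE; [exact: measurableI|exact: measurableI|exact: setSI].
pose C (e : I * J) := f @^-1` [set e.1] `*` g @^-1` [set e.2].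
have mC e : measurable (C e) by exact: measurableX.
(* If one of the two cells is null, the division returns 0. This is the right weight, since [p0a]
   and [p0b] give [p i j = 0] there. *)
pose w (e : I * J) := (p e.1 e.2 / (a setT e.1 * b setT e.2))%R.
have w0 e : (0 <= w e)%R by rewrite /w divr_ge0// mulr_ge0.
have PE A B e : measurable A -> measurable B ->
    (mu \x nu) (A `*` B `&` C e) = (a A e.1 * b B e.2)%:E.
  move=> mA mB; rewrite -setXI.
  rewrite EFinM -aE// -bE//.
  by apply: product_measure1E; exact: measurableI.
have sumE A B : measurable A -> measurable B ->
    \sum_e (w e)%:E * (mu \x nu) (A `*` B `&` C e)
    = (\sum_i \sum_j w (i, j) * (a A i * b B j))%:E.
  move=> mA mB; rewrite pair_bigA/= -sumEFin; apply: eq_bigr => -[i j] _.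
  by rewrite PE// EFinM.
have sumA A : measurable A ->
    (\sum_i \sum_j w (i, j) * (a A i * b setT j))%:E = mu A.
  move=> mA; rewrite partA// -sumEFin.
  apply: eq_bigr => i _; congr _%:E.
  have [ai0|ai0] := eqVneq (a setT i) 0%R.
    by rewrite (a0 _ _ mA ai0) big1// => j _; rewrite mul0r mulr0.
  transitivity (\sum_j p i j * (a A i / a setT i))%R.
    apply: eq_bigr => j _; rewrite /w/=.
    have [bj0|bj0] := eqVneq (b setT j) 0%R; first by rewrite p0b// !mul0r.
    by field; rewrite ai0 bj0.
  by rewrite -mulr_suml rowE mulrC divfK.
have sumB B : measurable B ->
    (\sum_i \sum_j w (i, j) * (a setT i * b B j))%:E = nu B.
  move=> mB; rewrite exchange_big/= partB// -sumEFin.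
  apply: eq_bigr => j _; congr _%:E.
  have [bj0|bj0] := eqVneq (b setT j) 0%R.
    by rewrite (b0 _ _ mB bj0) big1// => i _; rewrite !mulr0.
  transitivity (\sum_i p i j * (b B j / b setT j))%R.
    apply: eq_bigr => i _; rewrite /w/=.
    have [ai0|ai0] := eqVneq (a setT i) 0%R; first by rewrite p0a// !mul0r.
    by field; rewrite ai0 bj0.
  by rewrite -mulr_suml colE mulrC divfK.
have [|pi piE] := @reweighted_probability _ _ _ (mu \x nu) _ C w mC w0.
  transitivity (\sum_e (w e)%:E * (mu \x nu) (setT `*` setT `&` C e)).
    by apply: eq_bigr => e _; rewrite setXTT setTI.
  by rewrite sumE// sumA// probability_setT.
exists pi; split.
- move=> A mA; rewrite (_ : fst @^-1` A = A `*` setT); last first.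
    by apply/seteqP; split=> -[x y]//= [].
  by rewrite piE sumE// sumA.
- move=> B mB; rewrite (_ : snd @^-1` B = setT `*` B); last first.
    by apply/seteqP; split=> -[x y]//= [].
  by rewrite piE sumE// sumB.
- move=> i j; rewrite piE (bigD1 (i, j))//= big1 ?adde0; last first.
    move=> e eij; rewrite (_ : _ `&` _ = set0) ?measure0 ?mule0//.
    rewrite -subset0 => -[x y] /= [[fx gy] [fe ge]]; case/eqP: eij.
    by rewrite [e]surjective_pairing -fe -ge fx gy.
  rewrite -/(C (i, j)) setIid -[C _]setTI -setXTT PE//= -EFinM; congr _%:E.
  rewrite /w/=; have [ai0|ai0] := eqVneq (a setT i) 0%R; first by rewrite p0a// !mul0r.
  have [bj0|bj0] := eqVneq (b setT j) 0%R; first by rewrite p0b// !mul0r.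
  by rewrite divfK// mulf_neq0.
Qed.

End gluing.

(** * Marginals and weak duality *)

Section integration.
Context d (T : measurableType d) (R : realType) (P : probability T R).
Local Open Scope ereal_scope.

Lemma conullS (A B : set T) :
  measurable A -> measurable B -> A `<=` B -> P (~` A) = 0 -> P (~` B) = 0.
Proof.
move=> mA mB AB PA; apply/negligibleP; first exact: measurableC.
apply: (negligibleS (subsetC AB)); apply/negligibleP => //; exact: measurableC.
Qed.

Lemma ae_bounded_integrable (D : set T) (C : R) (h : T -> R) :
  measurable D -> P (~` D) = 0 -> measurable_fun setT h ->
  (forall x, D x -> `|h x| <= C)%R -> P.-integrable setT (EFin \o h).
Proof.
move=> mD PD mh hC; apply/integrableP; split; first exact/measurable_EFinP.
apply: (@le_lt_trans _ _ (\int[P]_x cst `|C|%:E x)).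
  apply: ae_ge0_le_integral => //.
  - by apply: measurableT_comp => //; exact/measurable_EFinP.
  - by move=> x _; rewrite lee_fin.
  exists (~` D); split => //; first exact: measurableC.
  move=> x /= nle Dx; apply: nle => _.
  by rewrite lee_fin (le_trans (hC _ Dx))// ler_norm.
have -> : \int[P]_x cst `|C|%:E x = `|C|%:E * P setT by exact: integral_cst.
by rewrite probability_setT mule1 ltry.
Qed.

Lemma le_integral_conull (D : set T) (f g : T -> \bar R) :
  measurable D -> P (~` D) = 0 ->
  P.-integrable setT f -> P.-integrable setT g ->
  (forall x, D x -> f x <= g x) -> \int[P]_x f x <= \int[P]_x g x.
Proof.
move=> mD PD fi gi fg.
rewrite (negligible_integral (measurableC mD))// [leRHS](negligible_integral (measurableC mD))//.
rewrite setDE setCK setTI; apply: le_integral => //.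
- exact: integrableS fi.
- exact: integrableS gi.
- by move=> x; rewrite inE => /fg.
Qed.

Lemma measurable_finite_range (I : finType) (f : T -> I) (h : I -> R) :
  (forall i, measurable (f @^-1` [set i])) -> measurable_fun setT (h \o f).
Proof.
move=> mf _ Y mY; rewrite setTI.
rewrite (_ : _ @^-1` _ = \bigcup_(i in [set i | Y (h i)]) (f @^-1` [set i])).
  by apply: fin_bigcup_measurable => // i _.
apply/seteqP; split => [x /= Yx|x [i /= Yi fxi]]; first by exists (f x).
by rewrite /= fxi.
Qed.

Lemma integrable_finite_range (I : finType) (f : T -> I) (h : I -> R) :
  (forall i, measurable (f @^-1` [set i])) ->
  P.-integrable setT (fun x => (h (f x))%:E).
Proof.
move=> mf; apply: (@ae_bounded_integrable setT (\sum_i `|h i|)%R (h \o f)) => //.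
- by rewrite setCT measure0.
- exact: measurable_finite_range.
- by move=> x _; rewrite (bigD1 (f x))//= lerDl sumr_ge0.
Qed.

Lemma integral_finite_range (I : finType) (f : T -> I) (h : I -> R) :
  (forall i, measurable (f @^-1` [set i])) ->
  \int[P]_x (h (f x))%:E = \sum_i (h i)%:E * P (f @^-1` [set i]).
Proof.
move=> mf.
transitivity (\int[P]_x \sum_i ((h i)%:E * (\1_(f @^-1` [set i]) x)%:E)).
  apply: eq_integral => x _; rewrite (bigD1 (f x))//= indicE mem_set// mule1.
  rewrite big1 ?adde0// => i ifx; rewrite indicE memNset ?mule0//=.
  by move=> fxi; rewrite fxi eqxx in ifx.
rewrite integral_sum//.
  apply: eq_bigr => i _; rewrite integralZl//; last exact: integrable_indic.
  by rewrite integral_indic// setIT.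
by move=> i; apply: integrableZl => //; exact: integrable_indic.
Qed.

End integration.

(** Change of variables through the pushforward of [P] by [f], which agrees with [Q] on measurable
    sets and hence has the same integrals. *)
Lemma integral_image_measure d1 d2 (X : measurableType d1) (Y : measurableType d2)
    (R : realType) (P : probability X R) (Q : probability Y R) (f : X -> Y)
    (h : Y -> R) :
  measurable_fun setT f ->
  (forall A, measurable A -> P (f @^-1` A) = Q A) ->
  Q.-integrable setT (EFin \o h) ->
  P.-integrable setT (EFin \o (h \o f)) /\
  (\int[P]_x (h (f x))%:E = \int[Q]_y (h y)%:E)%E.
Proof.
move=> mf PQ /integrableP[mh hoo].
have PfQ (k : Y -> \bar R) : (\int[pushforward P f]_y k y = \int[Q]_y k y)%E.
  by apply: eq_measure_integral => A mA _; exact: PQ.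
have hfi : P.-integrable setT (EFin \o (h \o f)).
  apply/integrableP; split; first exact: (measurableT_comp mh mf).
  move: hoo; rewrite -PfQ ge0_integral_pushforward//.
  exact: measurableT_comp.
by split=> //; rewrite -PfQ (integral_pushforward mf).
Qed.

Section marginals.
Context d1 d2 (T1 : measurableType d1) (T2 : measurableType d2) (R : realType).
Variables (mu : probability T1 R) (nu : probability T2 R).
Variable pi : probability (T1 * T2)%type R.
Hypothesis marginal1 : forall A, measurable A -> pi (fst @^-1` A) = mu A.
Hypothesis marginal2 : forall B, measurable B -> pi (snd @^-1` B) = nu B.
Local Open Scope ereal_scope.

(** The complement of a rectangle is covered by two cylinders, each of which is the preimage of a
    null set under a projection. *)
Lemma conull_marginals (A : set T1) (B : set T2) : measurable A -> measurable B ->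
  mu (~` A) = 0 -> nu (~` B) = 0 -> pi (~` (A `*` B)) = 0.
Proof.
move=> mA mB muA nuB.
have mA' := measurableC mA; have mB' := measurableC mB.
have mfA : measurable (@fst T1 T2 @^-1` (~` A)).
  by rewrite -[_ @^-1` _]setTI; exact: measurable_fst.
have msB : measurable (@snd T1 T2 @^-1` (~` B)).
  by rewrite -[_ @^-1` _]setTI; exact: measurable_snd.
apply/eqP; rewrite eq_le measure_ge0 andbT.
apply: (@le_trans _ _ (pi (fst @^-1` (~` A) `|` snd @^-1` (~` B)))).
  apply: le_measure; rewrite ?inE; [|exact: measurableU|].
    by apply: measurableC; exact: measurableX.
  by move=> [x y] /= /not_andP.
apply: (@le_trans _ _ (pi (fst @^-1` (~` A)) + pi (snd @^-1` (~` B)))).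
  exact: measureU2.
by rewrite marginal1// marginal2// muA nuB adde0.
Qed.

Lemma integral_marginal1 (phi : T1 -> R) : mu.-integrable setT (EFin \o phi) ->
  pi.-integrable setT (fun z => (phi z.1)%:E) /\
  \int[pi]_z (phi z.1)%:E = \int[mu]_x (phi x)%:E.
Proof. exact: integral_image_measure. Qed.

Lemma integral_marginal2 (psi : T2 -> R) : nu.-integrable setT (EFin \o psi) ->
  pi.-integrable setT (fun z => (psi z.2)%:E) /\
  \int[pi]_z (psi z.2)%:E = \int[nu]_y (psi y)%:E.
Proof. exact: integral_image_measure. Qed.

Lemma weak_duality (phi : T1 -> R) (psi : T2 -> R) (c : T1 -> T2 -> \bar R) :
  mu.-integrable setT (EFin \o phi) -> nu.-integrable setT (EFin \o psi) ->
  pi.-integrable setT (fun z => c z.1 z.2) ->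
  (forall x y, (phi x + psi y)%:E <= c x y) ->
  \int[mu]_x (phi x)%:E + \int[nu]_y (psi y)%:E <= \int[pi]_z c z.1 z.2.
Proof.
move=> /integral_marginal1[iphi <-] /integral_marginal2[ipsi <-] ic le_c.
rewrite -integralD//; apply: le_integral => //; first exact: integrableD.
by move=> z _; exact: le_c.
Qed.

End marginals.

(** * Costs of finite rank *)

(** The cell of [x] records which thresholds of an [h]-spaced grid each [u k x] reaches. Two values
    in [[-M, M]] more than [h] apart have a threshold between them, so their cells differ. Points
    where some [u k] exceeds [M] also have a cell, but nothing is claimed of them. *)
Lemma finite_quantization d (T : measurableType d) (R : realType) (K : finType)
    (u : K -> T -> R) (M h : R) :
  (forall k, measurable_fun setT (u k)) -> 0 < h ->
  exists (I : finType) (f : T -> I), (forall i, measurable (f @^-1` [set i])) /\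
    forall x y, f x = f y -> (forall k, `|u k x| <= M) -> (forall k, `|u k y| <= M) ->
      forall k, `|u k x - u k y| <= h.
Proof.
move=> mu h0; pose N := Num.truncn (2 * M / h).
(* The grid starts at [- M + h], and its last threshold [- M + (N + 1) h] lies above [M]. *)
pose t (l : 'I_N.+1) := - M + l.+1%:R * h.
pose f x := [ffun e : K * 'I_N.+1 => t e.2 <= u e.1 x].
exists {ffun K * 'I_N.+1 -> bool}, f; split.
  move=> b.
  have -> : f @^-1` [set b] = \bigcap_(e in [set: K * 'I_N.+1])
      [set x | (t e.2 <= u e.1 x) = b e].
    apply/seteqP; split => [x /= <- e _ /=|x H]; first by rewrite ffunE.
    by apply/ffunP => e; rewrite ffunE; exact: H.
  apply: fin_bigcap_measurable => // -[k l] _ /=.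
  have mle : measurable [set x | t l <= u k x].
    rewrite (_ : [set x | _] = u k @^-1` `[t l, +oo[%classic).
      by rewrite -[_ @^-1` _]setTI; apply: mu => //; exact: measurable_itv.
    by apply/seteqP; split => x /=; rewrite in_itv/= andbT.
  case: (b (k, l)); first exact: mle.
  rewrite (_ : [set x | _] = ~` [set x | t l <= u k x]); first exact: measurableC.
  by apply/seteqP; split => x /= => [->|/negP/negbTE].
have gap x y k : f x = f y -> (forall k, `|u k x| <= M) -> (forall k, `|u k y| <= M) ->
    u k y - u k x <= h.
  move=> fxy /(_ k) ux /(_ k) uy; rewrite leNgt; apply/negP => hlt.
  have s0 : 0 <= (u k x + M) / h.
    by rewrite divr_ge0 ?(ltW h0)//; move: ux; rewrite ler_norml => /andP[? _]; lra.
  have /andP[sl su] := truncn_itv s0.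
  (* Threshold number [s] is the first one above [u k x]. It is at most [u k x + h], hence below
     [u k y]. *)
  set s := Num.truncn ((u k x + M) / h) in sl su.
  have sN : (s < N.+1)%N.
    rewrite ltnS; apply: le_truncn; rewrite ler_pM2r ?invr_gt0//.
    by move: ux; rewrite ler_norml => /andP[_ ?]; lra.
  have := congr1 (fun b : {ffun _} => b (k, Ordinal sN)) fxy.
  rewrite !ffunE/= /t/=.
  move: sl su; rewrite ler_pdivlMr// ltr_pdivrMr// => sl su.
  have s1 : s.+1%:R * h = s%:R * h + h by rewrite -natr1 mulrDl mul1r.
  have -> : - M + s.+1%:R * h <= u k x = false by apply/negbTE; rewrite -ltNge; lra.
  by move=> /esym/negbT; rewrite -ltNge; lra.
move=> x y fxy ux uy k; rewrite ler_norml -[_ - _ <= _]opprK.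
by apply/andP; split; [rewrite lerNl opprB; exact: gap|exact: (gap y x)].
Qed.

(** As [D] is conull, the values [e] taken off [D] do not affect the integral. They stay free to be
    chosen so that a constraint imposed at every point holds there too. *)
Lemma extend_potential d (T : measurableType d) (R : realType) (P : probability T R)
    (D : set T) (I : finType) (f : T -> I) (h : I -> R) (e : T -> R) :
  measurable D -> P (~` D) = 0%E -> (forall i, measurable (f @^-1` [set i])) ->
  measurable_fun setT e ->
  let phi x := if x \in D then h (f x) else e x in
  P.-integrable setT (EFin \o phi) /\
  (\sum_i (h i)%:E * P (f @^-1` [set i]) <= \int[P]_x (phi x)%:E)%E.
Proof.
move=> mD PD mf me phi.
have iphi : P.-integrable setT (EFin \o phi).
  apply: (@ae_bounded_integrable _ _ _ _ D (\sum_i `|h i|)) => //.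
    apply: measurable_fun_ifT => //; last exact: measurable_finite_range.
    apply: (measurable_fun_bool true); rewrite setTI.
    by rewrite (_ : _ @^-1` _ = D)//; apply/seteqP; split=> x; [exact: set_mem|exact: mem_set].
  by move=> x Dx; rewrite /phi mem_set// (bigD1 (f x))//= lerDl sumr_ge0.
split=> //; rewrite -integral_finite_range//.
apply: (le_integral_conull mD PD) => //; first exact: integrable_finite_range.
by move=> x Dx; rewrite /phi mem_set.
Qed.

Section finite_rank.
Context d1 d2 (T1 : measurableType d1) (T2 : measurableType d2) (R : realType).
Context (mu : probability T1 R) (nu : probability T2 R).
Context (K : finType) (u : K -> T1 -> R) (v : K -> T2 -> R) (M : R).
Hypothesis mes_u : forall k, measurable_fun setT (u k).
Hypothesis mes_v : forall k, measurable_fun setT (v k).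
Hypothesis M0 : 0 <= M.
Let D1 := [set x | forall k, `|u k x| <= M].
Let D2 := [set y | forall k, `|v k y| <= M].
Hypothesis muD1 : mu (~` D1) = 0%E.
Hypothesis nuD2 : nu (~` D2) = 0%E.
Let c x y := \sum_k u k x * v k y.

Lemma measurable_bounded_family d (T : measurableType d) (w : K -> T -> R) :
  (forall k, measurable_fun setT (w k)) -> measurable [set x | forall k, `|w k x| <= M].
Proof.
move=> mw; rewrite (_ : [set x | _] =
    \bigcap_(k in [set: K]) ((fun x => `|w k x|) @^-1` `]-oo, M]%classic)).
  apply: fin_bigcap_measurable => // k _; rewrite -[_ @^-1` _]setTI.
  by apply: measurableT_comp => //; exact: measurable_itv.
apply/seteqP; split => [x H k _|x H k]; first by rewrite /= in_itv/=; exact: H.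
by have := H k Logic.I; rewrite /= in_itv.
Qed.

Let mD1 : measurable D1. Proof. exact: measurable_bounded_family. Qed.
Let mD2 : measurable D2. Proof. exact: measurable_bounded_family. Qed.

Let measurable_c : measurable_fun setT (fun z : T1 * T2 => c z.1 z.2).
Proof.
apply: measurable_sum => k; apply: measurable_funM.
- by apply: measurableT_comp => //; exact: measurable_fst.
- by apply: measurableT_comp => //; exact: measurable_snd.
Qed.

Let c_bounded x y : D1 x -> D2 y -> `|c x y| <= #|K|%:R * M ^+ 2.
Proof.
move=> D1x D2y; apply: (le_trans (ler_norm_sum _ _ _)).
rewrite mulr_natl -sumr_const; apply: ler_sum => k _.
by rewrite normrM expr2 ler_pM.
Qed.

Lemma finite_rank_integrable (pi : probability (T1 * T2)%type R) :
  (forall A, measurable A -> pi (fst @^-1` A) = mu A) ->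
  (forall B, measurable B -> pi (snd @^-1` B) = nu B) ->
  pi.-integrable setT (fun z => (c z.1 z.2)%:E).
Proof.
move=> m1 m2; apply: (@ae_bounded_integrable _ _ _ _ (D1 `*` D2)
  (#|K|%:R * M ^+ 2) (fun z => c z.1 z.2)) => //.
- exact: measurableX.
- exact: (conull_marginals m1 m2).
- by move=> [x y] [/= ? ?]; exact: c_bounded.
Qed.

(** Half of [eps] pays for replacing [c] by a cost constant on rectangles of cells, the other half
    for the finite duality. The resulting step potentials satisfy the constraint on [D1]*[D2] and
    are then modified on null sets to satisfy it everywhere. *)
Lemma finite_rank_duality (V eps : R) :
  (forall pi : probability (T1 * T2)%type R,
    (forall A, measurable A -> pi (fst @^-1` A) = mu A) ->
    (forall B, measurable B -> pi (snd @^-1` B) = nu B) ->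
    (V%:E <= \int[pi]_z (c z.1 z.2)%:E)%E) ->
  0 < eps ->
  exists (phi : T1 -> R) (psi : T2 -> R),
  [/\ mu.-integrable setT (EFin \o phi), nu.-integrable setT (EFin \o psi),
      forall x y, phi x + psi y <= c x y
    & ((V - eps)%:E <= \int[mu]_x (phi x)%:E + \int[nu]_y (psi y)%:E)%E].
Proof.
move=> Vmin eps0.
pose kap : R := #|K|%:R.
have kap0 : 0 <= kap by exact: ler0n.
(* Within a rectangle of cells [c] varies by at most [2 M h kap], and this [h] makes that at most
   [eps / 2]. The [+ 1] keeps the denominator positive when [M * kap = 0]. *)
pose h := eps / (2 * (2 * M * kap + 1)).
have Mk0 : 0 <= M * kap by rewrite mulr_ge0.
have h0 : 0 < h by rewrite divr_gt0//; nra.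
have [I [f [mf fosc]]] := finite_quantization M mes_u h0.
have [J [g [mg gosc]]] := finite_quantization M mes_v h0.
have osc x y x' y' : D1 x -> D1 x' -> D2 y -> D2 y' -> f x = f x' -> g y = g y' ->
    c x y - eps / 2 <= c x' y'.
  move=> D1x D1x' D2y D2y' fx gy.
  suff : c x y - c x' y' <= 2 * M * h * kap.
    suff : 2 * M * h * kap <= eps / 2 by lra.
    have : h * (2 * (2 * M * kap + 1)) = eps by rewrite divfK// gt_eqF//; nra.
    nra.
  rewrite /kap mulr_natr -sumr_const -sumrB; apply: ler_sum => k _.
  apply: (le_trans (ler_norm _)).
  have -> : u k x * v k y - u k x' * v k y'
    = u k x * (v k y - v k y') + (u k x - u k x') * v k y' by ring.
  apply: (le_trans (ler_normD _ _)); rewrite !normrM.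
  have := fosc _ _ fx D1x D1x' k; have := gosc _ _ gy D2y D2y' k.
  have := D1x k; have := D2y' k.
  move: (normr_ge0 (u k x)) (normr_ge0 (v k y')).
  move: (normr_ge0 (u k x - u k x')) (normr_ge0 (v k y - v k y')) => *.
  have -> : 2 * M * h = M * h + h * M by ring.
  by apply: lerD; apply: ler_pM.
pose S i j := [set c x y | x in D1 `&` f @^-1` [set i] & y in D2 `&` g @^-1` [set j]].
(* The infimum puts [cd] below [c], so potentials admissible for [cd] are admissible for [c] on
   [D1]*[D2]. A cell that misses [D1] or [D2] gets the default value of [inf], which enters the
   integrals only on null sets. *)
pose cd i j := inf (S i j).
have cd_le x y : D1 x -> D2 y -> cd (f x) (g y) <= c x y.
  move=> D1x D2y; apply: ge_inf; last by exists x => //; exists y.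
  exists (- (kap * M ^+ 2)) => _ [x' [D1x' _] [y' [D2y' _] <-]].
  by have := c_bounded D1x' D2y'; rewrite ler_norml => /andP[].
have le_cd x y : D1 x -> D2 y -> c x y <= cd (f x) (g y) + eps / 2.
  move=> D1x D2y; rewrite -lerBlDr; apply: lb_le_inf.
    by exists (c x y); exists x => //; exists y.
  by move=> _ [x' [D1x' fx'] [y' [D2y' gy'] <-]]; apply: osc => //; rewrite ?fx' ?gy'.
have eps2 : 0 < eps / 2 by lra.
pose m i := fine (mu (f @^-1` [set i])).
pose n j := fine (nu (g @^-1` [set j])).
have mE i : mu (f @^-1` [set i]) = (m i)%:E by rewrite fineK// fin_num_measure.
have nE j : nu (g @^-1` [set j]) = (n j)%:E by rewrite fineK// fin_num_measure.
have m1 : \sum_i m i = 1.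
  apply: EFin_inj; rewrite -sumEFin -(probability_setT mu).
  rewrite (measure_finite_partition mu mf)//.
  by apply: eq_bigr => i _; rewrite setTI -mE.
have n1 : \sum_j n j = 1.
  apply: EFin_inj; rewrite -sumEFin -(probability_setT nu).
  rewrite (measure_finite_partition nu mg)//.
  by apply: eq_bigr => j _; rewrite setTI -nE.
have [||||p p0 row col||phi0 [psi0 [le_c0 Vle]]] :=
    @finite_transport_duality R I J m n cd (V - eps / 2) (eps / 2) => //.
- by move=> i; exact: fine_ge0.
- by move=> j; exact: fine_ge0.
(* For a discrete coupling [p] lifted to [pi], the chain is [V <= \int c <= \int (cd + eps / 2) =
   \sum cd * p + eps / 2]. *)
- have [||pi [pi1 pi2 pic]] := @discrete_coupling_lift _ _ _ _ _ _ _ mu nu f g p mf mg p0.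
  + by move=> i; rewrite row mE.
  + by move=> j; rewrite col nE.
  rewrite lerBlDr -lee_fin; apply: (le_trans (Vmin pi pi1 pi2)).
  pose fg z := (f z.1, g z.2).
  have fgE i j : fg @^-1` [set (i, j)] = f @^-1` [set i] `*` g @^-1` [set j].
    by apply/seteqP; split => -[x y] /= [<- <-].
  have mfg e : measurable (fg @^-1` [set e]).
    by case: e => i j; rewrite fgE; exact: measurableX.
  pose cp (e : I * J) := cd e.1 e.2 + eps / 2.
  apply: (@le_trans _ _ (\int[pi]_z (cp (fg z))%:E)%E).
    apply: (@le_integral_conull _ _ _ _ (D1 `*` D2)) => //.
    - exact: measurableX.
    - exact: (conull_marginals pi1 pi2).
    - exact: finite_rank_integrable.
    - exact: integrable_finite_range.
    - by move=> [x y] [/= D1x D2y]; rewrite lee_fin; exact: le_cd.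
  rewrite integral_finite_range// le_eqVlt; apply/orP; left; apply/eqP.
  transitivity (\sum_(e : I * J) (cp e * p e.1 e.2)%:E)%E.
    by apply: eq_bigr => -[i j] _; rewrite fgE pic.
  rewrite sumEFin; congr _%:E.
  have p1 : \sum_(e : I * J) p e.1 e.2 = 1.
    by rewrite -(pair_bigA _ (fun i j => p i j))/= -m1; apply: eq_bigr.
  under eq_bigr do rewrite mulrDl.
  by rewrite big_split/= -mulr_sumr p1 mulr1 (pair_bigA _ (fun i j => cd i j * p i j)).
(* Off the full-measure set the constraint is met by the AM-GM bound
   [c x y >= - a u x - a v y]. *)
pose a (T : Type) (w : K -> T -> R) x := \sum_k w k x ^+ 2 / 2.
have le_ac x y : - a _ u x - a _ v y <= c x y.
  rewrite /a -opprD lerNl -big_split/= -sumrN; apply: ler_sum => k _.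
  by have := sqr_ge0 (u k x + v k y); nra.
have me d (T : measurableType d) (w : K -> T -> R) B :
    (forall k, measurable_fun setT (w k)) -> measurable_fun setT (fun x => - a _ w x - B).
  move=> mw; apply: measurable_funB => //; apply: measurableT_comp => //.
  apply: measurable_sum => k; apply: measurable_funM => //.
  exact: measurable_funX.
pose Q := kap * (M ^+ 2 / 2).
have aQ (T : Type) (w : K -> T -> R) x : (forall k, `|w k x| <= M) -> a _ w x <= Q.
  move=> wM; rewrite /Q /kap mulr_natl -sumr_const; apply: ler_sum => k _.
  by rewrite ler_pM2r// -real_normK ?num_real// ler_pXn2r ?nnegrE.
have Q0 : 0 <= Q by rewrite mulr_ge0// divr_ge0// sqr_ge0.
(* These shifts settle the mixed cases. If only [x] is in the bounded set, then [a u x <= Q] and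
   [B2] absorbs [phi0 (f x) + Q]; [B1] does the same with the roles exchanged. If neither point is,
   it suffices that both shifts are nonnegative. *)
pose B1 := \sum_j `|psi0 j| + Q; pose B2 := \sum_i `|phi0 i| + Q.
have le_B1 j : psi0 j + Q <= B1.
  by rewrite lerD2r (le_trans (ler_norm _))// (bigD1 j)//= lerDl sumr_ge0.
have le_B2 i : phi0 i + Q <= B2.
  by rewrite lerD2r (le_trans (ler_norm _))// (bigD1 i)//= lerDl sumr_ge0.
have B10 : 0 <= B1 by rewrite addr_ge0// sumr_ge0.
have B20 : 0 <= B2 by rewrite addr_ge0// sumr_ge0.
have [iphi Iphi] := @extend_potential _ _ _ mu D1 _ f phi0 (fun x => - a _ u x - B1)
  mD1 muD1 mf (me _ _ _ _ mes_u).
have [ipsi Ipsi] := @extend_potential _ _ _ nu D2 _ g psi0 (fun y => - a _ v y - B2)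
  mD2 nuD2 mg (me _ _ _ _ mes_v).
eexists; eexists; split; [exact: iphi|exact: ipsi| |].
- move=> x y; have := le_ac x y.
  case: ifPn => [/set_mem D1x|_]; case: ifPn => [/set_mem D2y|_] acxy.
  + exact: le_trans (le_c0 _ _) (cd_le _ _ D1x D2y).
  + by have := aQ _ _ _ D1x; have := le_B2 (f x); lra.
  + by have := aQ _ _ _ D2y; have := le_B1 (g y); lra.
  + lra.
- apply: le_trans (leeD Iphi Ipsi).
  under eq_bigr do rewrite mE -EFinM.
  under [X in (_ <= _ + X)%E]eq_bigr do rewrite nE -EFinM.
  by rewrite !sumEFin -EFinD lee_fin (le_trans _ Vle)//; lra.
Qed.

End finite_rank.

(** * Compactly supported measures on R^d *)

Section euclidean_space.
Context (R : realType) (d : nat).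
Implicit Types mu nu : probability (Rd R d) R.

Lemma measurable_coord (k : 'I_d) :
  measurable_fun setT (fun x : Rd R d => (x : 'rV[R]_d) ord0 k).
Proof.
apply: (measurability _ (RGenOInfty.measurableE R)) => _ [_ [a ->] <-].
rewrite setTI; apply: sub_sigma_algebra.
by apply: open_comp => // x _; exact: coord_continuous.
Qed.

Lemma measurable_box (N : R) :
  measurable ([set x | forall k, `|x ord0 k| <= N] : set (Rd R d)).
Proof. exact: (measurable_bounded_family N measurable_coord). Qed.

Lemma le_mx_norm_coord (x : 'rV[R]_d) k : `|x ord0 k| <= `|x|.
Proof.
rewrite [leRHS]/Num.norm/= mx_normrE.
by apply/bigmax_geP; right => /=; exists (ord0, k).
Qed.

(** Every point has an open neighbourhood whose part outside the box is null: a unit ball inside the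
    box at points of the support, a null open set elsewhere. Finitely many of them cover each
    compact cube [C n], and the cubes exhaust the space. *)
Lemma conull_box mu : compactly_supported mu ->
  exists2 N : R, 0 <= N & mu (~` [set x : 'rV[R]_d | forall k, `|x ord0 k| <= N]) = 0%E.
Proof.
move=> cS.
have [N0 [_ /(_ (`|N0| + 1))SN]] := compact_bounded cS.
(* The support lies in the sup-norm ball of radius [|N0| + 1]; one more unit leaves room for a unit
   ball around each of its points. *)
pose N := `|N0| + 2.
exists N; first by rewrite addr_ge0.
set B := [set x | _].
have mB : measurable (B : set (Rd R d)) := measurable_box N.
pose D := [set U : set 'rV[R]_d | open U /\ mu (U `\` B) = 0%E].
pose C (n : nat) := [set x : 'rV[R]_d | forall k, `[- n%:R, n%:R]%classic (x ord0 k)].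
have mopen (U : set 'rV[R]_d) : open U -> measurable (U : set (Rd R d)).
  by move=> oU; exact: sub_sigma_algebra.
have local_null x : exists2 U, D U & U x.
  have [Sx|Sx] := pselect (msupport mu x).
    exists (ball x 1)°; last exact: nbhsx_ballx.
    split; first exact: open_interior.
    rewrite (_ : _ `\` _ = set0) ?measure0// -subset0 => y [/interior_subset xy]; apply => k.
    have -> : y ord0 k = x ord0 k + (y ord0 k - x ord0 k) by ring.
    apply: (le_trans (ler_normD _ _)); rewrite /N.
    have -> : `|N0| + 2 = `|N0| + 1 + 1 by ring.
    apply: lerD.
      apply: (le_trans (le_mx_norm_coord _ _)); apply: SN => //.
      by rewrite (le_lt_trans (ler_norm _))// ltrDl.
    move: xy; rewrite -ball_normE /= => /ltW; apply: le_trans.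
    by have := le_mx_norm_coord (x - y) k; rewrite !mxE distrC.
  move/existsNP : Sx => [U /not_implyP[oU /not_implyP[Ux /negP]]].
  rewrite -leNgt => muU; exists U => //; split=> //.
  apply/eqP; rewrite eq_le measure_ge0 andbT (le_trans _ muU)//.
  have mU := mopen _ oU.
  by apply: le_measure; [exact: mem_set (measurableD _ _)|exact: mem_set|exact: subDsetl].
have nullC n : mu.-negligible (C n `\` B).
  have : compact (C n).
    by apply: (@rV_compact R _ (fun=> `[- n%:R, n%:R]%classic)) => _; exact: segment_compact.
  rewrite compact_cover => /(_ _ D id)[U []//|x _|F FD CF].
    by have [U] := local_null x; exists U.
  have : mu.-negligible (\bigcup_(U in [set` F]) (U `\` B)).
    rewrite bigcup_fset big_seq; apply: (big_ind (fun A : set (Rd R d) => mu.-negligible A)).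
    - exact: negligible_set0.
    - by move=> *; exact: negligibleU.
    - move=> U /FD/set_mem[oU muU]; apply/negligibleP => //.
      by apply: measurableD => //; exact: (mopen _ oU).
  apply: negligibleS => x [/CF[U /= UF Ux] Bx].
  by exists U.
have negl : mu.-negligible (\bigcup_n (C n `\` B)) by exact: negligible_bigcup.
apply/negligibleP; first exact: measurableC.
apply: negligibleS negl => x nBx.
exists (Num.truncn (\sum_k `|x ord0 k|)).+1 => //; split => // k.
rewrite /= in_itv/= -ler_norml.
apply: (@le_trans _ _ (\sum_k `|x ord0 k|)); last exact/ltW/truncnS_gt.
by rewrite (bigD1 k)//= lerDl sumr_ge0.
Qed.
End euclidean_space.

(** * Quadratic costs *)

(** Lets the transport infimum be handled through its real lower bounds, without first showing that
    it is finite. *)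
Lemma lee_real_below (R : realType) (a b : \bar R) :
  (forall r : R, r%:E <= a -> r%:E <= b)%E -> (a <= b)%E.
Proof.
case: a => [r|H|_]; [exact|rewrite leye_eq|exact: leNye].
apply/eqP/eqyP => A _; apply: H; exact: leey.
Qed.

Section transport_duality.
Context (R : realType) (d : nat) (mu nu : probability (Rd R d) R).

Lemma couplingP (pi : probability (Rd R d * Rd R d)%type R) : coupling mu nu pi <->
  (forall A, measurable A -> pi (fst @^-1` A) = mu A) /\
  (forall B, measurable B -> pi (snd @^-1` B) = nu B).
Proof.
split=> [H|[H1 H2] A mA]; last by split; [exact: H1|exact: H2].
by split => A mA; have [] := H A mA.
Qed.

(** Each real lower bound of the transport costs is approached by dual values up to an arbitrary
    error, which gives one inequality; weak duality gives the other. *)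
Lemma finite_rank_duality_eq (K : finType) (u v : K -> Rd R d -> R) (M : R)
    (c : Rd R d -> Rd R d -> \bar R) :
  (forall k, measurable_fun setT (u k)) -> (forall k, measurable_fun setT (v k)) ->
  0 <= M ->
  mu (~` [set x | forall k, `|u k x| <= M]) = 0%E ->
  nu (~` [set y | forall k, `|v k y| <= M]) = 0%E ->
  (forall x y, c x y = (\sum_k u k x * v k y)%:E) ->
  ereal_inf (transport_costs mu nu c) = ereal_sup (dual_values_below mu nu c).
Proof.
move=> mes_u mes_v M0 muD nuD cE; apply/eqP; rewrite eq_le; apply/andP; split.
  apply: lee_real_below => V Vinf; apply/lee_addgt0Pr => e e0.
  have [|phi [psi [iphi ipsi le_c Vle]]] :=
      @finite_rank_duality _ _ _ _ _ mu nu K u v M mes_u mes_v M0 muD nuD V e _ e0.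
    move=> pi pi1 pi2; apply: (le_trans Vinf); apply: ereal_inf_lbound.
    exists pi; first by apply/couplingP.
    by apply: eq_integral => z _; exact: cE.
  rewrite -leeBlDr// -EFinB; apply: (le_trans Vle); apply: ereal_sup_ubound.
  exists phi, psi; split => //; [exact/Lfun1_integrable|exact/Lfun1_integrable|].
  by move=> x y; rewrite cE lee_fin.
apply: ge_ereal_sup => _ [phi [psi [/Lfun1_integrable iphi /Lfun1_integrable ipsi le_c ->]]].
apply: le_ereal_inf_tmp => _ [pi /couplingP[pi1 pi2] <-].
apply: (weak_duality pi1 pi2) => //.
have := finite_rank_integrable mes_u mes_v muD nuD pi1 pi2.
by apply: eq_integrable => // z _; rewrite cE.
Qed.

Hypothesis mu_compact : compactly_supported mu.
Hypothesis nu_compact : compactly_supported nu.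

Definition quadratic (p q C : R) (A B : 'I_d -> R) (x y : 'rV[R]_d) : R :=
  \sum_k (p * (x ord0 k ^+ 2 + y ord0 k ^+ 2) + q * (x ord0 k * y ord0 k)
           + A k * x ord0 k + B k * y ord0 k) + C.

Lemma quadratic_finite_rank (p q C : R) (A B : 'I_d -> R) :
  exists (K : finType) (u v : K -> Rd R d -> R) (M : R),
  [/\ [/\ forall k, measurable_fun setT (u k), forall k, measurable_fun setT (v k) & 0 <= M],
      mu (~` [set x | forall k, `|u k x| <= M]) = 0%E,
      nu (~` [set y | forall k, `|v k y| <= M]) = 0%E
    & forall x y, quadratic p q C A B x y = \sum_k u k x * v k y].
Proof.
pose quad (a : 'I_d -> R) (x : Rd R d) :=
  \sum_k (p * (x : 'rV[R]_d) ord0 k ^+ 2 + a k * (x : 'rV[R]_d) ord0 k).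
have mquad a : measurable_fun setT (quad a).
  apply: measurable_sum => k; apply: measurable_funD; apply: measurable_funM => //.
    by apply: measurable_funX; exact: measurable_coord.
  exact: measurable_coord.
(* The terms are [(quad A x + C) * 1], [1 * quad B y], and one product [q x_i * y_i] per
   coordinate. *)
pose u (k : unit + unit + 'I_d) (x : Rd R d) : R := match k with
  | inl (inl _) => quad A x + C
  | inl (inr _) => 1
  | inr i => q * (x : 'rV[R]_d) ord0 i
  end.
pose v (k : unit + unit + 'I_d) (y : Rd R d) : R := match k with
  | inl (inl _) => 1
  | inl (inr _) => quad B y
  | inr i => (y : 'rV[R]_d) ord0 i
  end.
have [N1 N10 muN] := conull_box mu_compact.
have [N2 N20 nuN] := conull_box nu_compact.
pose Q (a : 'I_d -> R) N := \sum_k (`|p| * N ^+ 2 + `|a k| * N).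
have Q0 a N : 0 <= N -> 0 <= Q a N.
  by move=> N0; apply: sumr_ge0 => k _; rewrite addr_ge0 ?mulr_ge0 ?sqr_ge0.
have quad_le a N (x : 'rV[R]_d) : (forall k, `|x ord0 k| <= N) -> `|quad a x| <= Q a N.
  move=> xN; apply: (le_trans (ler_norm_sum _ _ _)); apply: ler_sum => k _.
  apply: (le_trans (ler_normD _ _)); rewrite normrM [X in _ + X]normrM normrX; apply: lerD.
    by rewrite ler_wpM2l// lerXn2r// ?nnegrE// (le_trans _ (xN k)).
  by rewrite ler_wpM2l.
(* A single bound for both families: the sum of the bounds of all factors on the two boxes. *)
pose M := Q A N1 + `|C| + Q B N2 + 1 + `|q| * N1 + N2.
have M0 : 0 <= M by rewrite !addr_ge0// ?Q0// mulr_ge0.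
have terms0 : [/\ 0 <= Q A N1, 0 <= `|C|, 0 <= Q B N2 & 0 <= `|q| * N1].
  by split; rewrite ?Q0// mulr_ge0.
have mes_u k : measurable_fun setT (u k).
  case: k => [[[]|[]]|i] /=; first exact: measurable_funD.
    exact: measurable_cst.
  by apply: measurable_funM => //; exact: measurable_coord.
have mes_v k : measurable_fun setT (v k).
  case: k => [[[]|[]]|i] /=; [exact: measurable_cst|exact: mquad|exact: measurable_coord].
exists (unit + unit + 'I_d)%type, u, v, M; split=> //.
- apply: (conullS (measurable_box N1) _ _ muN); first exact: measurable_bounded_family.
  move=> x xN; case: terms0 => *; case=> [[[]|[]]|i] /=.
  + by apply: (le_trans (ler_normD _ _)); have := quad_le A _ _ xN; rewrite /M; lra.
  + by rewrite normr1 /M; lra.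
  + have : `|q| * `|(x : 'rV[R]_d) ord0 i| <= `|q| * N1 by rewrite ler_wpM2l.
    by rewrite normrM /M; lra.
- apply: (conullS (measurable_box N2) _ _ nuN); first exact: measurable_bounded_family.
  move=> y yN; case: terms0 => *; case=> [[[]|[]]|i] /=.
  + by rewrite normr1 /M; lra.
  + by have := quad_le B _ _ yN; rewrite /M; lra.
  + by have := yN i; rewrite /M; lra.
- move=> x y.
  rewrite !big_sumType/= !(big_pred1 tt); [|by case|by case].
  rewrite mulr1 mul1r [LHS]addrC [quad A x + C]addrC -!addrA; congr (C + _).
  by rewrite -!big_split/=; apply: eq_bigr => k _; ring.
Qed.

Lemma quadratic_duality (p q C : R) (A B : 'I_d -> R) (c : Rd R d -> Rd R d -> \bar R) :
  (forall x y, c x y = (quadratic p q C A B x y)%:E) ->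
  ereal_inf (transport_costs mu nu c) = ereal_sup (dual_values_below mu nu c).
Proof.
move=> cE.
have [K [u [v [M [[mes_u mes_v M0] muD nuD qE]]]]] := quadratic_finite_rank p q C A B.
by apply: (finite_rank_duality_eq mes_u mes_v M0 muD nuD) => x y; rewrite cE qE.
Qed.

Lemma quadratic_integrable (pi : probability (Rd R d * Rd R d)%type R)
    (p q C : R) (A B : 'I_d -> R) : coupling mu nu pi ->
  pi.-integrable setT (fun z => (quadratic p q C A B z.1 z.2)%:E).
Proof.
move=> /couplingP[pi1 pi2].
have [K [u [v [M [[mes_u mes_v M0] muD nuD qE]]]]] := quadratic_finite_rank p q C A B.
have iuv := finite_rank_integrable mes_u mes_v muD nuD pi1 pi2.
apply: (eq_integrable measurableT _ _ _ iuv) => z _.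
by rewrite qE.
Qed.

End transport_duality.

Section quadratic_cost.
Context (R : realType) (d : nat).

(** The opposite cost is again quadratic, with all coefficients negated. Its duality, read through
    the negation that swaps infimum and supremum, is the claim. *)
Lemma quadratic_duality_sup (mu nu : probability (Rd R d) R)
    (p q C : R) (A B : 'I_d -> R) (c : Rd R d -> Rd R d -> \bar R) :
  compactly_supported mu -> compactly_supported nu ->
  (forall x y, c x y = (quadratic p q C A B x y)%:E) ->
  ereal_sup (transport_costs mu nu c) = ereal_inf (dual_values_above mu nu c).
Proof.
move=> cmu cnu cE; pose c' x y := (- c x y)%E.
have := @quadratic_duality R d mu nu cmu cnu (- p) (- q) (- C) (fun k => - A k)
  (fun k => - B k) c'.
have -> : transport_costs mu nu c' = [set (- z)%E | z in transport_costs mu nu c].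
  rewrite /transport_costs image_comp; apply: eq_imagel => pi pic /=.
  rewrite integralN//; apply: integrable_add_def; first exact: measurableT.
  apply: (eq_integrable measurableT _ _ _ (quadratic_integrable cmu cnu p q C A B pic)) => z _.
  by rewrite cE.
(* The same pair [f], [g] is admissible for both dual problems. Its two dual values are opposite,
   the integrals being finite. *)
have -> : dual_values_below mu nu c' = [set (- z)%E | z in dual_values_above mu nu c].
  have oppI (P : probability (Rd R d) R) (f : Rd R d -> R) : f \in Lfun P 1 ->
      (\int[P]_x (- f x)%:E = - \int[P]_x (f x)%:E)%E.
    move=> /Lfun1_integrable fi; rewrite -integralN//.
    by apply: integrable_add_def; first exact: measurableT.
  have sumI (f g : Rd R d -> R) : f \in Lfun mu 1 -> g \in Lfun nu 1 ->
      (\int[mu]_x (f x)%:E + \int[nu]_y (g y)%:E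
       = - (\int[mu]_x (- f x)%:E + \int[nu]_y (- g y)%:E))%E.
    move=> fL gL; rewrite !oppI// -oppeD ?oppeK// fin_num_adde_defr//.
    by apply: integrable_fin_num; [exact: measurableT|exact/Lfun1_integrable].
  have constraint (f g : Rd R d -> R) x y :
      ((f x + g y)%:E <= c' x y)%E = (c x y <= (- f x - g y)%:E)%E.
    by rewrite /c' -opprD EFinN leeNr.
  apply/seteqP; split => [_ [f [g [fL gL fg ->]]]|_ [_ [f [g [fL gL fg ->]]] <-]].
    exists (\int[mu]_x (- f x)%:E + \int[nu]_y (- g y)%:E)%E; last by rewrite -sumI.
    by exists f, g; split=> // x y; rewrite -constraint.
  by exists f, g; split=> // [x y|]; [rewrite constraint|rewrite -sumI].
rewrite ereal_infN ereal_supN => H; apply: oppe_inj; apply: H => x y.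
rewrite /c' cE -EFinN /quadratic opprD -sumrN; congr (_ + _)%:E.
by apply: eq_bigr => k _; ring.
Qed.

(** * Averaging the cost over a fixed plan *)

Lemma coupling_conull_box (mu nu : probability (Rd R d) R)
    (pi : probability (Rd R d * Rd R d)%type R) :
  compactly_supported mu -> compactly_supported nu -> coupling mu nu pi ->
  exists N : R, pi (~` [set z : Rd R d * Rd R d |
    (forall k, `|(z.1 : 'rV[R]_d) ord0 k| <= N) /\
    (forall k, `|(z.2 : 'rV[R]_d) ord0 k| <= N)]) = 0%E.
Proof.
move=> cmu cnu /couplingP[pi1 pi2].
have [N1 N10 muN] := conull_box cmu.
have [N2 N20 nuN] := conull_box cnu.
exists (N1 + N2).
have mB N := @measurable_box R d N.
apply: (conull_marginals pi1 pi2 (mB _) (mB _)).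
- by apply: (conullS (mB _) (mB _) _ muN) => x xN k; rewrite (le_trans (xN k))// lerDl.
- by apply: (conullS (mB _) (mB _) _ nuN) => x xN k; rewrite (le_trans (xN k))// lerDr.
Qed.

Lemma c_eE (alpha : R) (x y x' y' : 'rV[R]_d) :
  c_e alpha x y x' y' = \sum_k (2^-1 * (x ord0 k - y ord0 k) ^+ 2
    - 2^-1 * (x' ord0 k - y' ord0 k) ^+ 2
    + alpha / 3 * ((x ord0 k - x' ord0 k) ^+ 2
      + (x ord0 k - x' ord0 k) * (y ord0 k - y' ord0 k) + (y ord0 k - y' ord0 k) ^+ 2)).
Proof.
have enormE (z : 'rV[R]_d) : enorm z ^+ 2 = \sum_k z ord0 k ^+ 2.
  rewrite /enorm sqr_sqrtr; last by apply: sumr_ge0 => k _; rewrite -expr2 sqr_ge0.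
  by apply: eq_bigr => k _; rewrite expr2.
rewrite /c_e !enormE /dot !mulrDr !mulr_sumr -sumrN -!big_split/=.
by apply: eq_bigr => k _; rewrite !mxE; ring.
Qed.

(** Meant for [a], [b] the coordinates of the point held fixed during the integration: the integrals
    of [U], [V], [W] do not depend on that point and become the coefficients of the averaged
    cost. *)
Lemma integral_affine d' (T : measurableType d') (P : probability T R) (U V W : T -> R)
    (a b c : R) :
  P.-integrable setT (EFin \o U) -> P.-integrable setT (EFin \o V) ->
  P.-integrable setT (EFin \o W) ->
  P.-integrable setT (fun z => (a * U z + b * V z + W z + c)%:E) /\
  (\int[P]_z (a * U z + b * V z + W z + c)%:E
   = (a * fine (\int[P]_z (U z)%:E) + b * fine (\int[P]_z (V z)%:E)
      + fine (\int[P]_z (W z)%:E) + c)%:E)%E.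
Proof.
move=> iU iV iW.
have E z : (a * U z + b * V z + W z + c)%:E =
    (a%:E * (EFin \o U) z + b%:E * (EFin \o V) z + (EFin \o W) z + cst c%:E z)%E.
  by rewrite !EFinD !EFinM.
have iaU := integrableZl measurableT a iU.
have ibV := integrableZl measurableT b iV.
have ic : P.-integrable setT (cst c%:E) by exact: finite_measure_integrable_cst.
have i1 := integrableD measurableT iaU ibV.
have i2 := integrableD measurableT i1 iW.
have i3 := integrableD measurableT i2 ic.
split; first by apply: (eq_integrable measurableT _ _ _ i3) => z _; rewrite E.
under eq_integral do rewrite E.
rewrite integralD// integralD// integralD// integralZl// integralZl//.
have -> : (\int[P]_x cst c%:E x = c%:E * P setT)%E by exact: integral_cst.
by rewrite probability_setT mule1 !EFinD !EFinM !fineK//; exact: integrable_fin_num.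
Qed.

(* [s] is [1/2] for the cost averaged over [(x', y')], and [-1/2] for the one
   averaged over [(x, y)]. *)
Lemma integral_quadratic (s t N : R) (pi : probability (Rd R d * Rd R d)%type R) :
  pi (~` [set z : Rd R d * Rd R d | (forall k, `|(z.1 : 'rV[R]_d) ord0 k| <= N)
                  /\ (forall k, `|(z.2 : 'rV[R]_d) ord0 k| <= N)]) = 0%E ->
  exists (A B : 'I_d -> R) (C : R), forall x y : 'rV[R]_d,
  (\int[pi]_z (\sum_k (s * (x ord0 k - y ord0 k) ^+ 2
    - s * ((z.1 : 'rV[R]_d) ord0 k - (z.2 : 'rV[R]_d) ord0 k) ^+ 2
    + t * ((x ord0 k - (z.1 : 'rV[R]_d) ord0 k) ^+ 2
      + (x ord0 k - (z.1 : 'rV[R]_d) ord0 k) * (y ord0 k - (z.2 : 'rV[R]_d) ord0 k)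
      + (y ord0 k - (z.2 : 'rV[R]_d) ord0 k) ^+ 2)))%:E)%E
  = (quadratic (s + t) (t - 2 * s) C A B x y)%:E.
Proof.
set D := [set z | _] => piD.
pose X k (z : Rd R d * Rd R d) : R := (z.1 : 'rV[R]_d) ord0 k.
pose Y k (z : Rd R d * Rd R d) : R := (z.2 : 'rV[R]_d) ord0 k.
have mX k : measurable_fun setT (X k).
  by apply: (measurableT_comp (measurable_coord k)); exact: measurable_fst.
have mY k : measurable_fun setT (Y k).
  by apply: (measurableT_comp (measurable_coord k)); exact: measurable_snd.
have mD : measurable D.
  rewrite (_ : D = [set x : Rd R d | forall k, `|(x : 'rV[R]_d) ord0 k| <= N]
    `*` [set x : Rd R d | forall k, `|(x : 'rV[R]_d) ord0 k| <= N])//.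
  by apply: measurableX; exact: measurable_box.
(* In the expansion of the [k]-th summand in the coordinates of [x] and [y], [U] is the coefficient
   of [x_k], [V] that of [y_k], and [W] the term free of both. The remaining quadratic terms, [cst_]
   below, do not involve [z]. *)
pose U k z := - t * (2 * X k z + Y k z).
pose V k z := - t * (X k z + 2 * Y k z).
pose W k z := (t - s) * X k z ^+ 2 + (2 * s + t) * (X k z * Y k z) + (t - s) * Y k z ^+ 2.
have iU k : pi.-integrable setT (EFin \o U k).
  apply: (@ae_bounded_integrable _ _ _ pi D (`|t| * (3 * N))) => //.
    by apply: measurable_funM => //; apply: measurable_funD => //; exact: measurable_funM.
  move=> z [/(_ k) zX /(_ k) zY]; rewrite normrM normrN ler_wpM2l//.
  by move: zX zY; rewrite !ler_norml /X /Y; lra.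
have iV k : pi.-integrable setT (EFin \o V k).
  apply: (@ae_bounded_integrable _ _ _ pi D (`|t| * (3 * N))) => //.
    by apply: measurable_funM => //; apply: measurable_funD => //; exact: measurable_funM.
  move=> z [/(_ k) zX /(_ k) zY]; rewrite normrM normrN ler_wpM2l//.
  by move: zX zY; rewrite !ler_norml /X /Y; lra.
have iW k : pi.-integrable setT (EFin \o W k).
  apply: (@ae_bounded_integrable _ _ _ pi D
      (`|t - s| * N ^+ 2 + `|2 * s + t| * N ^+ 2 + `|t - s| * N ^+ 2)) => //.
    by repeat (apply: measurable_funD || apply: measurable_funM || apply: measurable_funX).
  move=> z [/(_ k) zX /(_ k) zY].
  have XX : `|X k z ^+ 2| <= N ^+ 2 by rewrite normrX lerXn2r// nnegrE (le_trans _ zX).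
  have YY : `|Y k z ^+ 2| <= N ^+ 2 by rewrite normrX lerXn2r// nnegrE (le_trans _ zY).
  have XY : `|X k z * Y k z| <= N ^+ 2 by rewrite normrM expr2 ler_pM.
  apply: (le_trans (ler_normD _ _)); apply: lerD; last by rewrite normrM ler_wpM2l.
  by apply: (le_trans (ler_normD _ _)); rewrite !normrM -normrM lerD// ler_wpM2l// -normrM.
exists (fun k => fine (\int[pi]_z (U k z)%:E)), (fun k => fine (\int[pi]_z (V k z)%:E)),
  (\sum_k fine (\int[pi]_z (W k z)%:E)).
move=> x y.
pose cst_ k := (s + t) * (x ord0 k ^+ 2 + y ord0 k ^+ 2) + (t - 2 * s) * (x ord0 k * y ord0 k).
have aff k := @integral_affine _ _ pi (U k) (V k) (W k) (x ord0 k) (y ord0 k) (cst_ k)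
  (iU k) (iV k) (iW k).
transitivity (\int[pi]_z
    \sum_k (x ord0 k * U k z + y ord0 k * V k z + W k z + cst_ k)%:E)%E.
  apply: eq_integral => z _; rewrite sumEFin; congr _%:E; apply: eq_bigr => k _.
  by rewrite /U /V /W /cst_ /X /Y; ring.
rewrite integral_sum//; last by move=> k; have [] := aff k.
under eq_bigr => k _ do rewrite (proj2 (aff k)).
rewrite sumEFin /quadratic -big_split/=; congr _%:E; apply: eq_bigr => k _.
by rewrite /cst_; ring.
Qed.

End quadratic_cost.

Theorem theorem1p5 (R : realType) (d : nat)
  (mu1 nu1 mu2 nu2 : probability (Rd R d) R) (alpha : R)
  (pi1s pi2s : probability (Rd R d * Rd R d)%type R)
  (mu1_compact : compactly_supported mu1) (mu1_ac : abs_continuous mu1)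
  (nu1_compact : compactly_supported nu1) (nu1_ac : abs_continuous nu1)
  (mu2_compact : compactly_supported mu2) (mu2_ac : abs_continuous mu2)
  (nu2_compact : compactly_supported nu2) (nu2_ac : abs_continuous nu2)
  (alpha_gt0 : 0 < alpha)
  (pi1s_coupling : coupling mu1 nu1 pi1s)
  (pi2s_coupling : coupling mu2 nu2 pi2s) :
  ereal_inf (transport_costs mu1 nu1 (c_e_pi2 alpha pi2s))
    = ereal_sup (dual_values_below mu1 nu1 (c_e_pi2 alpha pi2s))
  /\
  ereal_sup (transport_costs mu2 nu2 (c_e_pi1 alpha pi1s))
    = ereal_inf (dual_values_above mu2 nu2 (c_e_pi1 alpha pi1s)).
Proof.
have [N1 pi1N] := coupling_conull_box mu1_compact nu1_compact pi1s_coupling.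
have [N2 pi2N] := coupling_conull_box mu2_compact nu2_compact pi2s_coupling.
have [A1 [B1 [C1 int1]]] := integral_quadratic (- 2^-1) (alpha / 3) pi1N.
have [A2 [B2 [C2 int2]]] := integral_quadratic 2^-1 (alpha / 3) pi2N.
split.
- apply: (quadratic_duality mu1_compact nu1_compact) => x y.
  apply: etrans (int2 x y).
  by apply: eq_integral => z _; rewrite c_eE.
- apply: (quadratic_duality_sup mu2_compact nu2_compact) => x' y'.
  apply: etrans (int1 x' y').
  (* Exchanging the two pairs leaves the [alpha] term unchanged and reverses the sign of the
     difference of squares, hence the coefficient [- 2^-1] in [int1]. *)
  apply: eq_integral => z _; rewrite c_eE; congr _%:E.
  by apply: eq_bigr => k _; ring.
Qed.
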